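(* Let $S$ be any proper, nonempty subset of $[n-1]$, and let $\bar S=[n-1]\setminus S$. Then \[\max\{d_\ell(\sigma,\rho):\sigma,\rho\in\mathcal{D}(S;n),\ \sigma\ne\rho\}=\max\{d_\ell(\sigma,\rho):\sigma,\rho\in\mathcal{D}(\bar S;n),\ \sigma\ne\rho\}.\]
   Context: $S_n$ is the symmetric group on $[n]=\{1,\ldots,n\}$, with permutations in one-line notation $\sigma=\sigma_1\cdots\sigma_n$. The descent set of $\sigma$ is $\mathcal{D}(\sigma)=\{j\in[n-1]:\sigma_j>\sigma_{j+1}\}$, and for $S\subseteq[n-1]$, $\mathcal{D}(S;n)=\{\sigma\in S_n:\mathcal{D}(\sigma)=S\}$. The $\ell_\infty$-metric is $d_\ell(\sigma,\rho)=\max\{|\sigma_j-\rho_j|:1\le j\le n\}$. *)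

(* Defs.v *)
From mathcomp Require Import all_boot all_order all_fingroup all_algebra.
From mathcomp Require Import zify.

Set Implicit Arguments.
Unset Strict Implicit.
Unset Printing Implicit Defensive.

Import Order.TTheory GRing.Theory Num.Theory.

(* Positions and values are 0-based: [n] is 'I_n and [n-1] is 'I_n.-1, so that
   j : 'I_n.-1 stands for the pair of consecutive positions j, j.+1 of 'I_n. *)

Fact pos_next_subproof (n : nat) (j : 'I_n.-1) : j.+1 < n.
Proof. by rewrite -ltn_predRL. Qed.

Definition pos (n : nat) (j : 'I_n.-1) : 'I_n := widen_ord (leq_pred n) j.

Definition pos_next (n : nat) (j : 'I_n.-1) : 'I_n :=
  Ordinal (pos_next_subproof j).

Definition descent_set (n : nat) (s : 'S_n) : {set 'I_n.-1} :=
  [set j | s (pos_next j) < s (pos j)].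

Definition descent_class (n : nat) (S : {set 'I_n.-1}) : {set 'S_n} :=
  [set s : 'S_n | descent_set s == S].

Definition dist_linf (n : nat) (s r : 'S_n) : nat :=
  \max_(j < n) absz ((s j)%:Z - (r j)%:Z)%R.

Definition distinct_pairs (T : finType) (A : {set T}) : {set T * T} :=
  [set p | [&& p.1 \in A, p.2 \in A & p.1 != p.2]].

Lemma rank_perm (n : nat) (f : 'I_n -> int) : injective f ->
  exists s : 'S_n, forall i j, (s i < s j) = (f i < f j)%R.
Proof.
move=> f_inj; pose B i := [set k | f k < f i]%R.
have ltB i : #|B i| < n.
  rewrite -[X in _ < X]card_ord -cardsT; apply: proper_card.
  by rewrite properT; apply/eqP => /setP/(_ i); rewrite !inE ltxx.
have monoB i j : (f i < f j)%R -> #|B i| < #|B j|.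
  move=> lt_ij; apply: proper_card; apply/properP; split.
    by apply/subsetP => k; rewrite !inE => /lt_trans; apply.
  by exists i; rewrite !inE ?lt_ij ?ltxx.
pose r i : 'I_n := Ordinal (ltB i).
have r_inj : injective r.
  move=> i j /(congr1 val) /= eq_ij; apply: f_inj.
  by case: (ltgtP (f i) (f j)) => // /monoB; rewrite eq_ij ltnn.
exists (perm r_inj) => i j; rewrite !permE /=.
case: (ltgtP (f i) (f j)) => [/monoB//|/monoB|/f_inj->]; last exact: ltnn.
by move/ltnW; rewrite ltnNge => ->.
Qed.

(* Both maxima in the theorem range over nonempty sets, so that the value 0 of
   \max over an empty range never occurs. *)
Lemma distinct_pairs_descent_class_neq0 (n : nat) (S : {set 'I_n.-1}) :
  S != set0 -> S \proper [set: 'I_n.-1] ->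
  distinct_pairs (descent_class S) != set0.
Proof.
case: n S => [|n] S /=; first by case/set0Pn => -[].
case/set0Pn => [a aS] /properP [_ [b _ bS]].
pose P k := [exists j in S, val j == k].
have PE (j : 'I_n) : P j = (j \in S).
  apply/existsP/idP => [[i /andP[iS /eqP/val_inj <-//]]|jS].
  by exists j; rewrite jS eqxx.
pose f (i : 'I_n.+1) : int := if P i.-1 then (- (i : nat)%:Z)%R else (i : nat)%:Z%R.
pose g (i : 'I_n.+1) : int :=
  if P i then (n%:Z - (i : nat)%:Z)%R else ((i : nat)%:Z - n%:Z)%R.
have f_inj : injective f.
  by move=> i j; rewrite /f => eq_ij; apply: val_inj => /=; move: eq_ij; do 2!case: ifP => _; lia.
have g_inj : injective g.
  move=> i j; rewrite /g => eq_ij; apply: val_inj => /=; move: eq_ij.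
  by have := ltn_ord i; have := ltn_ord j; do 2!case: ifP => _; lia.
have [s sE] := rank_perm f_inj; have [r rE] := rank_perm g_inj.
apply/set0Pn; exists (s, r); rewrite !inE /=; apply/and3P; split.
- apply/eqP/setP => j; rewrite inE sE /f /= PE.
  by case: (j \in S); case: ifP => _; lia.
- apply/eqP/setP => j; rewrite inE rE /g /= PE.
  by have := ltn_ord j; case: (j \in S); case: ifP => _; lia.
apply/eqP => eq_sr.
have fg i j : (f i < f j)%R = (g i < g j)%R by rewrite -sE -rE eq_sr.
have := fg ord_max (@pos n.+1 a); have := fg ord_max (@pos n.+1 b).
rewrite /f /g /= !PE aS (negPf bS).
have := ltn_ord a; have := ltn_ord b.
by do !case: ifP => _; lia.
Qed.

(* Main.v *)
(** Complementing the values, [σ_j ↦ n + 1 - σ_j], turns descents into ascents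
    and preserves the l-infinity distance, so it carries the pairs for [S]
    bijectively to the pairs for the complement of [S]. *)

Require Import Defs.
From mathcomp Require Import all_boot all_order all_fingroup all_algebra.
From mathcomp Require Import zify.

(** Products of permutations apply the left factor first, so the reversal acts on values, not on
    positions. *)
Definition perm_compl (n : nat) (s : 'S_n) : 'S_n :=
  (s * perm rev_ord_inj)%g.

Lemma perm_complE (n : nat) (s : 'S_n) i : perm_compl n s i = rev_ord (s i).
Proof. by rewrite permM permE. Qed.

Lemma perm_complK (n : nat) : involutive (perm_compl n).
Proof. by move=> s; apply/permP => i; rewrite !perm_complE rev_ordK. Qed.

Lemma descent_set_compl (n : nat) (s : 'S_n) :
  descent_set (perm_compl n s) = ~: descent_set s.
Proof.
apply/setP => j; rewrite !inE !perm_complE /=.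
(* By injectivity adjacent values never tie, so a non-descent is a strict ascent. *)
have ne : s (pos_next j) != s (pos j) :> nat.
  by apply/eqP => /val_inj/perm_inj/(congr1 val) /=; lia.
by have := ltn_ord (s (pos_next j)); have := ltn_ord (s (pos j)); lia.
Qed.

Lemma dist_linf_compl (n : nat) (s r : 'S_n) :
  dist_linf (perm_compl n s) (perm_compl n r) = dist_linf s r.
Proof.
apply: eq_bigr => j _; rewrite !perm_complE /=.
(* The bounds make the truncated subtraction in [rev_ord] exact. *)
by have := ltn_ord (s j); have := ltn_ord (r j); lia.
Qed.

Lemma mem_descent_class_compl (n : nat) (S : {set 'I_n.-1}) (s : 'S_n) :
  (perm_compl n s \in descent_class (~: S)) = (s \in descent_class S).
Proof. by rewrite !inE descent_set_compl (inj_eq (can_inj (@setCK _))). Qed.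

Theorem theorem5p5 (n : nat) (S : {set 'I_n.-1})
    (S_neq0 : S != set0) (S_proper : S \proper [set: 'I_n.-1]) :
  \max_(p in distinct_pairs (descent_class S)) dist_linf p.1 p.2 =
  \max_(p in distinct_pairs (descent_class (~: S))) dist_linf p.1 p.2.
Proof.
pose c (p : 'S_n * 'S_n) := (perm_compl n p.1, perm_compl n p.2).
have cK : involutive c by case=> s r; rewrite /c /= !perm_complK.
(* Reindexing along [c] leaves equal ranges and equal summands to check. *)
rewrite [RHS](reindex_inj (inv_inj cK)) /=.
apply: eq_big => [[s r]|[s r] _]; last by rewrite /= dist_linf_compl.
(* Only the outer membership is unfolded, keeping [descent_class] intact for the rewrite. *)
rewrite [LHS]in_set [RHS]in_set /= !mem_descent_class_compl.
by rewrite (inj_eq (inv_inj (perm_complK n))).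
Qed.
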